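(* Let $\epsilon>0$, $c(\epsilon):=\epsilon/\sqrt5$, and $q\ge1$ an integer. If $w_A,w_B:\mathbb{Z}/q\mathbb{Z}\to[0,1]$ satisfy $\sum_{t\in\mathbb{Z}/q\mathbb{Z}}w_A(t)\ge(\tfrac38+\epsilon)q$ and $\sum_{t\in\mathbb{Z}/q\mathbb{Z}}w_B(t)\ge(\tfrac38+\epsilon)q$, then $$\sum_{t\in\mathbb{Z}/q\mathbb{Z}}(w_A*w_B)(t)\,f_q(t)\ \ge\ c(\epsilon)\,q.$$
   Context: For $f,g:\mathbb{Z}/q\mathbb{Z}\to\mathbb{C}$, the convolution is $(f*g)(x):=\frac1q\sum_{a\in\mathbb{Z}/q\mathbb{Z}}f(a)g(x-a)$. The function $f_q:\mathbb{Z}/q\mathbb{Z}\to\mathbb{R}$ is $f_q(t):=\#\{x\in\mathbb{Z}/q\mathbb{Z}:x^2=t\}$. *)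

(* Defs.v *)
From HB Require Import structures.
From mathcomp Require Import all_boot all_order all_algebra.
From mathcomp Require Import reals.
Set Implicit Arguments. Unset Strict Implicit. Unset Printing Implicit Defensive.
Import Order.TTheory GRing.Theory Num.Theory.
Local Open Scope ring_scope.

(* Z/qZ is represented by 'I_q (q >= 1), with arithmetic taken mod q. *)
Lemma zq_mod_lt (q : nat) (i : 'I_q) (m : nat) : (m %% q < q)%N.
Proof. by rewrite ltn_pmod // (leq_ltn_trans (leq0n _) (ltn_ord i)). Qed.

Definition zq_sub (q : nat) (x a : 'I_q) : 'I_q :=
  Ordinal (zq_mod_lt x (x + (q - a))).

Definition zq_mul (q : nat) (x y : 'I_q) : 'I_q :=
  Ordinal (zq_mod_lt x (x * y)).

Definition zq_conv (R : realType) (q : nat) (f g : 'I_q -> R) (x : 'I_q) : R :=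
  q%:R^-1 * \sum_(a : 'I_q) f a * g (zq_sub x a).

Definition fq (R : realType) (q : nat) (t : 'I_q) : R :=
  #|[set x : 'I_q | zq_mul x x == t]|%:R.

(* Main.v *)
Require Import Defs.
From HB Require Import structures.
From mathcomp Require Import all_boot all_order all_algebra.
From mathcomp Require Import reals.
From mathcomp Require Import ring lra zify.
Import Order.TTheory GRing.Theory Num.Theory.
Local Open Scope ring_scope.
Set Implicit Arguments. Unset Strict Implicit. Unset Printing Implicit Defensive.

(* With A = wA, C(a) = wB(-a) and averages over Z/N (N any multiple of q), the
   claim is a lower bound for Q(A, C) = E_x E_a A(x^2 + a) C(a).  Take
   N = 8q = 2^k m with m odd and split Z/N by the Chinese remainder theorem.
   For every modulus N one shows
     Q(A, C) >= (3/4) (ac - (3/10) a(1 - a) - (3/10) c(1 - c)),    a = E A, c = E C,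
   and when a, c >= 3/8 + eps the right-hand side is at least (9/20) eps.

   Powers of 2.  Squares of odd numbers are equidistributed in the class 1 mod 8,
   so odd x only see the class averages u_i, v_i (i mod 8) of A and C, as the
   products u_{i+1} v_i.  Even x pair classes congruent mod 4, and there
   E f g >= max(0, E f + E g - 1) >= (9/20) (s^2 - s) with s = E f + E g.  The
   coefficient 9/20 makes the linear terms cancel, and a quadratic form on the
   nonnegative orthant remains.  It is concave along (u_{i+1}, v_i) -> (u_{i+1} + s,
   v_i - s), so one of u_{i+1}, v_i may be taken to be 0 for each i, which
   leaves 3^4 cases.

   Odd moduli.  For f of mean 0, E_j (E_x f(x^2 + j))^2 is at most the average over u
   of |P_u f|^2, where P_u averages over cosets of the subgroup generated by u.
   Since u, u+1, u+2 are pairwise coprime relative to the odd modulus, P_u f,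
   P_{u+1} f, P_{u+2} f are orthogonal, whence the bound |f|^2 / 3.  Applied to the
   fibre averages, this loses at most (3/10)(Var X + Var Y), which the squared
   terms of the bound for powers of 2 pay for exactly. *)

(** * A copositive quadratic form *)

(** What remains of the form in [octagon_form_ge0] once every product u_{i+1} v_i vanishes: [P i]
    stands for u_{i+1} + u_{i+5}, [Q i] for v_i + v_{i+4}, and the even squares give the products
    P_{i-1} Q_i, indices mod 4. *)
Definition cycle_form (R : realFieldType) (P Q a b : nat -> R) : R :=
  a 0 + a 1 + a 2 + a 3 + (b 0 + b 1 + b 2 + b 3)
  + (P 3 * Q 0 + P 0 * Q 1 + P 1 * Q 2 + P 2 * Q 3)
  - (P 0 + P 1 + P 2 + P 3 + (Q 0 + Q 1 + Q 2 + Q 3)) ^+ 2 / 6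
  + (P 0 + P 1 + P 2 + P 3 - (Q 0 + Q 1 + Q 2 + Q 3)) ^+ 2 / 24.

(* [n i] and [2 - n i] say how many of two variables feed [P i] and [Q i]; [a i] and
   [b i] stand for the sums of their squares. *)
Definition capped (R : realFieldType) (n : nat -> nat) (P Q a b : nat -> R) :=
  forall i, [/\ (n i <= 2)%N, [/\ 0 <= P i, 0 <= Q i, 0 <= a i & 0 <= b i],
                P i ^+ 2 <= (n i)%:R * a i & Q i ^+ 2 <= (2 - n i)%:R * b i].

(* Three times the least [m] with [(P + Q)^2 / m <= P^2 / n + P Q + Q^2 / n'] for
   all [P, Q >= 0], where [n = 0] forces [P = 0] and [n' = 0] forces [Q = 0]. *)
Definition width (n n' : nat) : nat :=
  if (n == 1) && (n' == 1) then 4 else 3 * maxn n n'.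

(** Put m = [width n n'] / 3 and s = P + Q. If m = 0 then s = 0; otherwise the right side is at
    least s^2 / m >= 2 k s - m k^2, a tangent line. Being linear in s, the bound can be added over
    groups that share one [k]. *)
Lemma group_bound (R : realFieldType) (n n' : nat) (k a b P Q : R) :
  (n <= 2)%N -> (n' <= 2)%N -> 0 <= P -> 0 <= Q -> 0 <= a -> 0 <= b ->
  P ^+ 2 <= n%:R * a -> Q ^+ 2 <= n'%:R * b ->
  2 * k * (P + Q) - (width n n')%:R / 3 * k ^+ 2 <= a + b + P * Q.
Proof.
have sq0 (x c : R) : x ^+ 2 <= 0%:R * c -> x = 0.
  by rewrite mul0r => h; apply/eqP; rewrite -sqrf_eq0 eq_le h sqr_ge0.
have := sqr_ge0 (P + Q - 2 * k); have := sqr_ge0 (P + Q - k).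
have := sqr_ge0 (P + Q - 4 / 3 * k); have := sqr_ge0 (P - Q).
case: n => [|[|[|//]]]; case: n' => [|[|[|//]]] s1 s2 s3 s4 _ _ P0 Q0 a0 b0.
all: have PQ := mulr_ge0 P0 Q0.
all: move=> Pa Qb; try (move/sq0: (Pa) => Pe; subst P); try (move/sq0: (Qb) => Qe; subst Q).
all: match goal with |- context [width ?i ?j] =>
       let w := eval compute in (width i j) in change (width i j) with w end.
all: nra.
Qed.

(** Cauchy-Schwarz over the groups (P_{i-1}, Q_i): if S is the sum of all P and Q and k = S / 6, the
    four bounds add up to at least 12 k^2 - (18 / 3) k^2 = S^2 / 6. *)
Lemma cycle_form_ge0_narrow (R : realFieldType) n (P Q a b : nat -> R) :
  capped n P Q a b ->
  (width (n 3) (2 - n 0) + width (n 0) (2 - n 1) + width (n 1) (2 - n 2)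
   + width (n 2) (2 - n 3) <= 18)%N ->
  0 <= cycle_form P Q a b.
Proof.
move=> cap; rewrite -(ler_nat R) !natrD => w.
pose k := (P 0 + P 1 + P 2 + P 3 + (Q 0 + Q 1 + Q 2 + Q 3)) / 6.
have G i j : 2 * k * (P i + Q j) - (width (n i) (2 - n j))%:R / 3 * k ^+ 2
    <= a i + b j + P i * Q j.
  have [ni [Pi _ ai _] ca _] := cap i; have [_ [_ Qj _ bj] _ cb] := cap j.
  by apply: group_bound ca cb => //; rewrite leq_subr.
have := G 3 0; have := G 0 1; have := G 1 2; have := G 2 3.
have := mulr_ge0 (sqr_ge0 k) (_ : 0 <= 18%:R - ((width (n 3) (2 - n 0))%:R
  + (width (n 0) (2 - n 1))%:R + (width (n 1) (2 - n 2))%:R + (width (n 2) (2 - n 3))%:R)).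
rewrite subr_ge0 => /(_ w).
have := sqr_ge0 (P 0 + P 1 + P 2 + P 3 - (Q 0 + Q 1 + Q 2 + Q 3)).
rewrite /cycle_form.
set d := (P 0 + _ + _ + _ - _) ^+ 2.
have -> : P 0 + P 1 + P 2 + P 3 + (Q 0 + Q 1 + Q 2 + Q 3) = 6 * k by rewrite /k; field.
set w30 := (width (n 3) _)%:R; set w01 := (width (n 0) _)%:R.
set w12 := (width (n 1) _)%:R; set w23 := (width (n 2) _)%:R.
have E : k * (P 0 + P 1 + P 2 + P 3 + (Q 0 + Q 1 + Q 2 + Q 3)) = 6 * k ^+ 2 by rewrite /k; field.
move: E; clearbody k w30 w01 w12 w23 d; clear.
move: (P 0) (P 1) (P 2) (P 3) (Q 0) (Q 1) (Q 2) (Q 3) => p0 p1 p2 p3 q0 q1 q2 q3.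
lra.
Qed.

(* Up to rotation and reflection, these are the cases of total width above 18; the sums of
   squares are LDL^T decompositions of the form. *)
Lemma light_cycle_ge0 (R : realFieldType) n (P Q a b : nat -> R) :
  capped n P Q a b -> (n 1 <= n 0 <= 1)%N -> n 2 = 0%N -> n 3 = 0%N ->
  0 <= cycle_form P Q a b.
Proof.
move=> cap /andP[n10 n01] n2 n3.
have [_ [_ _ a3 b3]] := cap 3%N; have [_ [_ _ a2 b2]] := cap 2%N.
have [_ [_ _ a1 b1]] := cap 1%N; have [_ [_ _ a0 b0]] := cap 0%N.
rewrite n2 n3 /cycle_form; move: (n 0%N) n01 (n 1%N) n10.
clear n cap n2 n3.
move: (a 0) (a 1) (a 2) (a 3) (b 0) (b 1) (b 2) (b 3) a0 a1 a2 a3 b0 b1 b2 b3.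
move=> {a} a0 a1 a2 a3 {b} b0 b1 b2 b3 ga0 ga1 ga2 ga3 gb0 gb1 gb2 gb3.
move: (P 0) (P 1) (P 2) (P 3) (Q 0) (Q 1) (Q 2) (Q 3) => P0 P1 P2 P3 Q0 Q1 Q2 Q3.
have sq0 (x c : R) : x ^+ 2 <= 0 * c -> x = 0.
  by rewrite mul0r => h; apply/eqP; rewrite -sqrf_eq0 eq_le h sqr_ge0.
case=> [|[|//]] _; case=> [|[|//]] // _; rewrite ?subn0 ?subn1 /=.
- move=> /sq0-> h1 /sq0-> h2 /sq0-> h3 /sq0-> h4.
  have : 0 <= 3/8 * (Q0 - 1/3 * Q1 - 1/3 * Q2 - 1/3 * Q3) ^+ 2
      + 1/3 * (Q1 - 1/2 * Q2 - 1/2 * Q3) ^+ 2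
      + 1/4 * (Q2 - Q3) ^+ 2.
    by repeat apply: addr_ge0; (apply: mulr_ge0; [lra|exact: sqr_ge0]).
  lra.
- move=> h1 h2 h3' h3 h4' h4 h5' h5.
  move: h3' h4' h5' => /sq0 e1 /sq0 e2 /sq0 e3; rewrite e1 e2 e3.
  have : 0 <= 7/8 * (P0 - 5/21 * Q0 + 1/3 * Q1 - 5/21 * Q2 - 5/21 * Q3) ^+ 2
      + 52/63 * (Q0 - 7/104 * Q1 - 11/52 * Q2 - 11/52 * Q3) ^+ 2
      + 57/208 * (Q1 - 14/57 * Q2 - 14/57 * Q3) ^+ 2
      + 31/114 * (Q2 - 26/31 * Q3) ^+ 2
      + 5/62 * Q3 ^+ 2.
    by repeat apply: addr_ge0; (apply: mulr_ge0; [lra|exact: sqr_ge0]).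
  lra.
- move=> h1 h2 h3 h4 h5' h5 h6' h6.
  move: h5' h6' => /sq0 e1 /sq0 e2; rewrite e1 e2.
  have : 0 <= 7/8 * (P0 - 1/7 * P1 - 5/21 * Q0 + 1/3 * Q1 - 5/21 * Q2 - 5/21 * Q3) ^+ 2
      + 6/7 * (P1 - 5/18 * Q0 - 7/36 * Q1 + 11/36 * Q2 - 5/18 * Q3) ^+ 2
      + 41/54 * (Q0 - 11/82 * Q1 - 11/82 * Q2 - 13/41 * Q3) ^+ 2
      + 30/41 * (Q1 - 1/40 * Q2 - 11/60 * Q3) ^+ 2
      + 37/160 * (Q2 - 22/37 * Q3) ^+ 2
      + 17/222 * Q3 ^+ 2.
    by repeat apply: addr_ge0; (apply: mulr_ge0; [lra|exact: sqr_ge0]).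
  lra.
Qed.

(** [f] holds the terms of the octagon form that vary when mass moves between x = u_{i+1} and y =
    v_i with x + y fixed: [k] comes from the products with neighbouring classes, [D] from the rest
    of the total difference. *)
Lemma push_edge (R : realFieldType) (k D x y : R) : 0 <= x -> 0 <= y ->
  let f u v := 20 / 9 * (u * v) + u ^+ 2 + v ^+ 2 + k * u + (u - v + D) ^+ 2 / 24 in
  f (x + y) 0 <= f x y \/ f 0 (x + y) <= f x y.
Proof.
(* concavity, multiplied by [x + y]: [18 ((x + y) f x y - y f 0 (x + y) - x f (x + y) 0)
   = x y (x + y)] *)
move=> x0 y0 f; have [|xy] := leP (f (x + y) 0) (f x y); first by left.
have [|yx] := leP (f 0 (x + y)) (f x y); first by right.
exfalso.
have /eqP E : y * (f 0 (x + y) - f x y) + x * (f (x + y) 0 - f x y) == - (x * y * (x + y)) / 18.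
  by rewrite /f; apply/eqP; field.
have p : 0 <= x * y * (x + y) by rewrite !mulr_ge0 ?addr_ge0.
have h1 : 0 <= y * (f 0 (x + y) - f x y) by rewrite mulr_ge0 // subr_ge0 ltW.
have h2 : 0 <= x * (f (x + y) 0 - f x y) by rewrite mulr_ge0 // subr_ge0 ltW.
have [xe|xn] := eqVneq x 0.
  by move: yx; rewrite xe add0r ltxx.
have [ye|yn] := eqVneq y 0.
  by move: xy; rewrite ye addr0 ltxx.
have : 0 < x * y * (x + y) by rewrite !mulr_gt0 ?addr_gt0 // lt0r ?xn ?yn.
lra.
Qed.

(** Rotations and reflections of the 4-cycle preserve the form, a reflection exchanging P with Q and
    n with 2 - n. Each of the 81 choices of n is narrow or is carried by a symmetry to
    [light_cycle_ge0]. *)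
Lemma cycle_form_ge0 (R : realFieldType) n (P Q a b : nat -> R) :
  capped n P Q a b -> 0 <= cycle_form P Q a b.
Proof.
move=> cap.
have cap_rot r : capped (fun i => n ((i + r) %% 4)%N) (fun i => P ((i + r) %% 4)%N)
    (fun i => Q ((i + r) %% 4)%N) (fun i => a ((i + r) %% 4)%N) (fun i => b ((i + r) %% 4)%N).
  by move=> i; apply: cap.
(* [r + 3 * i] stands for r - i modulo 4, avoiding truncated subtraction. *)
have cap_rev r : capped (fun i => 2 - n ((r + 3 * i) %% 4)%N)%N (fun i => Q ((r + 3 * i) %% 4)%N)
    (fun i => P ((r + 3 * i) %% 4)%N) (fun i => b ((r + 3 * i) %% 4)%N)
    (fun i => a ((r + 3 * i) %% 4)%N).
  move=> i; have [ni [Pi Qi ai bi] ca cb] := cap ((r + 3 * i) %% 4)%N.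
  by split=> //; rewrite ?leq_subr ?subKn.
have [/cycle_form_ge0_narrow|] := boolP (width (n 3) (2 - n 0) + width (n 0) (2 - n 1)
  + width (n 1) (2 - n 2) + width (n 2) (2 - n 3) <= 18)%N; first exact.
have rotE r : (r < 4)%N -> cycle_form (fun i => P ((i + r) %% 4)%N) (fun i => Q ((i + r) %% 4)%N)
    (fun i => a ((i + r) %% 4)%N) (fun i => b ((i + r) %% 4)%N) = cycle_form P Q a b.
  by case: r => [|[|[|[|//]]]] _; rewrite /cycle_form /=; ring.
have revE r : (r < 4)%N -> cycle_form (fun i => Q ((r + 3 * i) %% 4)%N)
    (fun i => P ((r + 3 * i) %% 4)%N) (fun i => b ((r + 3 * i) %% 4)%N)
    (fun i => a ((r + 3 * i) %% 4)%N) = cycle_form P Q a b.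
  by case: r => [|[|[|[|//]]]] _; rewrite /cycle_form /=; ring.
move=> wide.
have [r r4] : exists2 r, (r < 4)%N &
   [&& n ((1 + r) %% 4) <= n ((0 + r) %% 4) <= 1, n ((2 + r) %% 4) == 0 & n ((3 + r) %% 4) == 0]%N
|| [&& 2 - n ((r + 3 * 1) %% 4) <= 2 - n ((r + 3 * 0) %% 4) <= 1,
       n ((r + 3 * 2) %% 4) == 2 & n ((r + 3 * 3) %% 4) == 2]%N.
  have [[n0 _ _ _] [n1 _ _ _]] := (cap 0%N, cap 1%N).
  have [[n2 _ _ _] [n3 _ _ _]] := (cap 2%N, cap 3%N).
  case E0: (n 0%N) n0 => [|[|[|//]]] _; case E1: (n 1%N) n1 => [|[|[|//]]] _;
  case E2: (n 2%N) n2 => [|[|[|//]]] _; case E3: (n 3%N) n3 => [|[|[|//]]] _;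
  move: wide; rewrite E0 E1 E2 E3 //= => _;
  by [exists 0%N; rewrite //= ?E0 ?E1 ?E2 ?E3|exists 1%N; rewrite //= ?E0 ?E1 ?E2 ?E3
     |exists 2%N; rewrite //= ?E0 ?E1 ?E2 ?E3|exists 3%N; rewrite //= ?E0 ?E1 ?E2 ?E3].
case/orP=> [/and3P[n10 /eqP n2 /eqP n3]|/and3P[n10 /eqP n2 /eqP n3]].
  by rewrite -(rotE r) //; apply: light_cycle_ge0 (cap_rot r) _ _ _.
by rewrite -(revE r) //; exact: light_cycle_ge0 (cap_rev r) n10
  (congr1 (subn 2) n2) (congr1 (subn 2) n3).
Qed.

(* [n] counts how many of the sums [x + y], [x' + y'] are moved entirely to the first side. *)
Lemma push_pair (R : realFieldType) (k D x x' y y' : R) :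
  0 <= x -> 0 <= x' -> 0 <= y -> 0 <= y' ->
  exists n P Q a b, [/\ [/\ (n <= 2)%N, [/\ 0 <= P, 0 <= Q, 0 <= a & 0 <= b],
      P ^+ 2 <= n%:R * a & Q ^+ 2 <= (2 - n)%:R * b], P + Q = x + x' + y + y' &
    a + b + k * P + (P - Q + D) ^+ 2 / 24 <=
    20 / 9 * (x * y + x' * y') + (x ^+ 2 + x' ^+ 2) + (y ^+ 2 + y' ^+ 2)
      + k * (x + x') + (x + x' - (y + y') + D) ^+ 2 / 24].
Proof.
move=> x0 x'0 y0 y'0.
have xy0 := addr_ge0 x0 y0; have xy'0 := addr_ge0 x'0 y'0.
have := (sqr_ge0 (x + y - (x' + y')), sqr_ge0 (x + y), sqr_ge0 (x' + y')) => -[[d s] s'].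
have [h|h] := push_edge k (D + x' - y') x0 y0.
- have [h'|h'] := push_edge k (D + x + y) x'0 y'0.
  + exists 2%N, (x + y + (x' + y')), 0, ((x + y) ^+ 2 + (x' + y') ^+ 2), 0.
    split; [split; [by []|split; lra|lra|]|ring|move: h h'; lra].
    by rewrite ?subnn ?subn0 ?subn1 /=; lra.
  + exists 1%N, (x + y), (x' + y'), ((x + y) ^+ 2), ((x' + y') ^+ 2).
    split; [split; [by []|split; lra|lra|]|ring|move: h h'; lra].
    by rewrite ?subnn ?subn0 ?subn1 /=; lra.
- have [h'|h'] := push_edge k (D - x - y) x'0 y'0.
  + exists 1%N, (x' + y'), (x + y), ((x' + y') ^+ 2), ((x + y) ^+ 2).
    split; [split; [by []|split; lra|lra|]|ring|move: h h'; lra].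
    by rewrite ?subnn ?subn0 ?subn1 /=; lra.
  + exists 0%N, 0, (x + y + (x' + y')), 0, ((x + y) ^+ 2 + (x' + y') ^+ 2).
    split; [split; [by []|split; lra|lra|]|ring|move: h h'; lra].
    by rewrite ?subnn ?subn0 ?subn1 /=; lra.
Qed.

(** Moving the four pairs of edges in turn by [push_pair] keeps the total of all variables and only
    lowers the form, down to a [cycle_form]. *)
Lemma octagon_form_ge0 (R : realFieldType) (u v : nat -> R) :
  (forall i, 0 <= u i) -> (forall i, 0 <= v i) ->
  0 <= 20 / 9 * (u 1 * v 0 + u 2 * v 1 + u 3 * v 2 + u 4 * v 3
                 + u 5 * v 4 + u 6 * v 5 + u 7 * v 6 + u 0 * v 7)
    + (u 0 ^+ 2 + u 1 ^+ 2 + u 2 ^+ 2 + u 3 ^+ 2 + u 4 ^+ 2 + u 5 ^+ 2 + u 6 ^+ 2 + u 7 ^+ 2)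
    + (v 0 ^+ 2 + v 1 ^+ 2 + v 2 ^+ 2 + v 3 ^+ 2 + v 4 ^+ 2 + v 5 ^+ 2 + v 6 ^+ 2 + v 7 ^+ 2)
    + ((u 0 + u 4) * (v 0 + v 4) + (u 1 + u 5) * (v 1 + v 5)
       + (u 2 + u 6) * (v 2 + v 6) + (u 3 + u 7) * (v 3 + v 7))
    - (u 0 + u 1 + u 2 + u 3 + u 4 + u 5 + u 6 + u 7
       + (v 0 + v 1 + v 2 + v 3 + v 4 + v 5 + v 6 + v 7)) ^+ 2 / 6
    + (u 0 + u 1 + u 2 + u 3 + u 4 + u 5 + u 6 + u 7
       - (v 0 + v 1 + v 2 + v 3 + v 4 + v 5 + v 6 + v 7)) ^+ 2 / 24.
Proof.
move=> u0 v0.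
pose p0 := u 1 + u 5; pose p1 := u 2 + u 6; pose p2 := u 3 + u 7; pose p3 := u 4 + u 0.
pose q0 := v 0 + v 4; pose q1 := v 1 + v 5; pose q2 := v 2 + v 6; pose q3 := v 3 + v 7.
(* Here [k] and [D] use the new [P], [Q] for pairs already moved and the original sums for the
   others. *)
have [n0 [P0 [Q0 [a0 [b0 [c0 S0 h0]]]]]] :=
  push_pair (q1 - p3) (p1 + p2 + p3 - q1 - q2 - q3) (u0 1) (u0 5) (v0 0) (v0 4).
have [n1 [P1 [Q1 [a1 [b1 [c1 S1 h1]]]]]] :=
  push_pair (q2 - P0) (P0 + p2 + p3 - Q0 - q2 - q3) (u0 2) (u0 6) (v0 1) (v0 5).
have [n2 [P2 [Q2 [a2 [b2 [c2 S2 h2]]]]]] :=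
  push_pair (q3 - P1) (P0 + P1 + p3 - Q0 - Q1 - q3) (u0 3) (u0 7) (v0 2) (v0 6).
have [n3 [P3 [Q3 [a3 [b3 [c3 S3 h3]]]]]] :=
  push_pair (Q0 - P2) (P0 + P1 + P2 - Q0 - Q1 - Q2) (u0 4) (u0 0) (v0 3) (v0 7).
pose sel T (t0 t1 t2 t3 : T) i := match i with 0 => t0 | 1 => t1 | 2 => t2 | _ => t3 end.
have : capped (sel _ n0 n1 n2 n3) (sel _ P0 P1 P2 P3) (sel _ Q0 Q1 Q2 Q3)
              (sel _ a0 a1 a2 a3) (sel _ b0 b1 b2 b3).
  by case=> [|[|[|i]]].
move=> /cycle_form_ge0; rewrite /cycle_form /sel /=.
have {S0} Q0E : Q0 = q0 + p0 - P0 by rewrite /q0 /p0; move: S0; lra.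
have {S1} Q1E : Q1 = q1 + p1 - P1 by rewrite /q1 /p1; move: S1; lra.
have {S2} Q2E : Q2 = q2 + p2 - P2 by rewrite /q2 /p2; move: S2; lra.
have {S3} Q3E : Q3 = q3 + p3 - P3 by rewrite /q3 /p3; move: S3; lra.
move: h0 h1 h2 h3; rewrite Q0E Q1E Q2E Q3E {c0 c1 c2 c3 Q0E Q1E Q2E Q3E}.
rewrite /p0 /p1 /p2 /p3 /q0 /q1 /q2 /q3.
move: (u 0) (u 1) (u 2) (u 3) (u 4) (u 5) (u 6) (u 7) => w0 w1 w2 w3 w4 w5 w6 w7.
move: (v 0) (v 1) (v 2) (v 3) (v 4) (v 5) (v 6) (v 7) => z0 z1 z2 z3 z4 z5 z6 z7.
lra.
Qed.

(** * Averages of periodic functions and powers of two *)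

Definition avg (R : realFieldType) (N : nat) (f : nat -> R) : R :=
  N%:R^-1 * \sum_(i < N) f i.

(** Functions on Z/N are modelled as N-periodic functions on [nat], so that one function can be
    averaged over any multiple of its period and evaluated at unreduced polynomials. *)
Definition periodic (R : realFieldType) (N : nat) (f : nat -> R) :=
  forall n, f (n + N)%N = f n.

Lemma eq_avg (R : realFieldType) N (f g : nat -> R) : f =1 g -> avg N f = avg N g.
Proof. by move=> fg; congr (_ * _); apply: eq_bigr. Qed.

Lemma avgD (R : realFieldType) N (f g : nat -> R) :
  avg N (fun i => f i + g i) = avg N f + avg N g.
Proof. by rewrite /avg big_split mulrDr. Qed.

Lemma avgZ (R : realFieldType) N (c : R) f : avg N (fun i => c * f i) = c * avg N f.
Proof. by rewrite /avg -mulr_sumr mulrCA. Qed.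

Lemma avg_const (R : realFieldType) N (c : R) : (0 < N)%N -> avg N (fun=> c) = c.
Proof.
move=> N0; rewrite /avg sumr_const card_ord -[c *+ N]mulr_natr mulrCA mulVf ?mulr1 //.
by rewrite pnatr_eq0 -lt0n.
Qed.

Lemma ler_avg (R : realFieldType) N (f g : nat -> R) :
  (forall i, f i <= g i) -> avg N f <= avg N g.
Proof. by move=> fg; rewrite ler_wpM2l ?invr_ge0 //; apply: ler_sum => i _. Qed.

Lemma avg_ge0 (R : realFieldType) N (f : nat -> R) :
  (forall i, 0 <= f i) -> 0 <= avg N f.
Proof. by move=> f0; rewrite mulr_ge0 ?invr_ge0 // sumr_ge0. Qed.

Lemma exchange_avg (R : realFieldType) N M (F : nat -> nat -> R) :
  avg N (fun i => avg M (F i)) = avg M (fun j => avg N (F^~ j)).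
Proof.
rewrite /avg -!mulr_sumr !mulrA [_^-1 * _^-1]mulrC; congr (_ * _).
exact: exchange_big.
Qed.

Lemma periodicM (R : realFieldType) N (f : nat -> R) k n :
  periodic N f -> f (n + k * N)%N = f n.
Proof.
move=> per; elim: k => [|k IH]; first by rewrite addn0.
by rewrite mulSn [(N + _)%N]addnC addnA per.
Qed.

Lemma periodic_congr (R : realFieldType) N (f : nat -> R) m n :
  periodic N f -> m = n %[mod N] -> f m = f n.
Proof.
move=> per mn; rewrite (divn_eq m N) (divn_eq n N) mn.
by rewrite ![(_ * N + _)%N]addnC !periodicM.
Qed.

Lemma avg_shift (R : realFieldType) N (f : nat -> R) c :
  periodic N f -> avg N (fun i => f (i + c)%N) = avg N f.
Proof.
move=> per; elim: c => [|c IH]; first by apply: eq_avg => i; rewrite addn0.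
rewrite -IH; congr (_ * _); case: N per {IH} => [|N] per; first by rewrite !big_ord0.
rewrite big_ord_recr big_ord_recl /= addrC add0n; congr (_ + _).
  by rewrite -[RHS]per; congr f; lia.
by apply: eq_bigr => i _; congr f; rewrite /bump /=; lia.
Qed.

Lemma avg_split (R : realFieldType) a b (f : nat -> R) :
  avg (a * b) f = avg a (fun i => avg b (fun h => f (i + a * h)%N)).
Proof.
rewrite /avg -mulr_sumr mulrA natrM invfM; congr (_ * _).
elim: b => [|b IH]; first by rewrite muln0 big_ord0 big1 // => i _; rewrite big_ord0.
rewrite mulnSr big_split_ord /= IH.
under [RHS]eq_bigr => i _ do rewrite big_ord_recr /=.
rewrite big_split /=; congr (_ + _).
by apply: eq_bigr => i _; rewrite addnC.
Qed.

Lemma avg_periods (R : realFieldType) k N (f : nat -> R) :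
  (0 < k)%N -> periodic N f -> avg (N * k) f = avg N f.
Proof.
move=> k0 per; rewrite avg_split; apply: eq_avg => i.
rewrite -[RHS](avg_const _ k0); apply: eq_avg => h.
by rewrite mulnC periodicM.
Qed.

(** * Squares modulo powers of 2 and the bound for these moduli *)

Lemma odd_sqr_mod8 z : exists w, ((2 * z + 1) ^ 2 = 1 + w * 8)%N.
Proof.
exists (z * z.+1)./2.
have := odd_double_half (z * z.+1); rewrite oddM /= andbN add0n -!mulnn; lia.
Qed.

(* Shifting z by 2^(k-2) adds 2^k to (2z+1)^2 modulo 2^(k+1), which halves the modulus. *)
Lemma avg_odd_square (R : realFieldType) j (f : nat -> R) b :
  periodic (8 * 2 ^ j) f ->
  avg (8 * 2 ^ j) (fun z => f ((2 * z + 1) ^ 2 + b)%N) =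
  avg (2 ^ j) (fun h => f (1 + b + 8 * h)%N).
Proof.
elim: j f b => [|j IH] f b per.
  rewrite muln1 in per *; have cf h : f (1 + b + 8 * h)%N = f (1 + b)%N.
    by rewrite mulnC periodicM.
  rewrite (eq_avg _ cf) avg_const // -[RHS](@avg_const R 8) //; apply: eq_avg => z.
  have [w ->] := odd_sqr_mod8 z.
  by rewrite addnAC periodicM.
set t := (2 ^ j)%N in IH; have t0 : (0 < t)%N by rewrite expn_gt0.
have E2 : (2 ^ j.+1 = t * 2)%N by rewrite expnS mulnC.
rewrite {}E2 mulnA in per *.
(* The mean of [f] over the two lifts of a residue mod 8t to a residue mod 16t; both sides depend on
   [f] only through it. *)
pose f' n := 1 / 2 * (f n + f (n + 8 * t)%N).
have per' : periodic (8 * t) f'.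
  move=> n; rewrite /f' addrC; congr (_ * (_ + _)).
  by rewrite -addnA -[(8 * t + _)%N]/(8 * t + 8 * t)%N addnn -muln2 per.
transitivity (avg (8 * t * 2) (fun z => f' ((2 * z + 1) ^ 2 + b)%N)).
  have perF : periodic (8 * t * 2) (fun z => f ((2 * z + 1) ^ 2 + b)%N).
    move=> z; rewrite -[RHS](periodicM (64 * t + 8 * z + 4) _ per); congr f; ring.
  rewrite avgZ avgD.
  rewrite (_ : avg _ (fun z => f (_ + _ + _)%N)
      = avg (8 * t * 2) (fun z => f ((2 * z + 1) ^ 2 + b)%N)).
    lra.
  rewrite -[RHS](avg_shift (2 * t) perF); apply: eq_avg => z.
  by rewrite -[LHS](periodicM (z + t) _ per); congr f; ring.
rewrite avg_periods //; last first.
  by move=> z; rewrite -[RHS](periodicM (32 * t + 8 * z + 4) _ per'); congr f'; ring.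
have perG : periodic t (fun h => f' (1 + b + 8 * h)%N).
  by move=> h; rewrite -[RHS]per'; congr f'; ring.
rewrite IH // -(avg_periods (k := 2)) // /f' avgZ avgD.
have perH : periodic (t * 2) (fun h => f (1 + b + 8 * h)%N).
  by move=> h; rewrite -[RHS]per; congr f; ring.
rewrite (_ : avg _ (fun h => f (_ + _ * _ + _)%N) = avg (t * 2) (fun h => f (1 + b + 8 * h)%N)).
  lra.
rewrite -[RHS](avg_shift t perH); apply: eq_avg => h.
by congr f; ring.
Qed.

Lemma avg_itv (R : realFieldType) N (f : nat -> R) : (0 < N)%N ->
  (forall n, 0 <= f n <= 1) -> 0 <= avg N f <= 1.
Proof.
move=> N0 f01; rewrite avg_ge0 ?andTb => [|n]; last by case/andP: (f01 n).
by rewrite -[leRHS](avg_const _ N0) ler_avg // => n; case/andP: (f01 n).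
Qed.

(** Let s be the sum of the two averages. If s <= 1 the left side is at most 0; if 1 <= s <= 2 it is
    (9/20) s (s - 1) <= s - 1, and s - 1 is a lower bound because (1 - f)(1 - g) >= 0. *)
Lemma avg_conv_ge (R : realFieldType) t (f g : nat -> R) : (0 < t)%N ->
  (forall n, 0 <= f n <= 1) -> (forall n, 0 <= g n <= 1) ->
  9 / 20 * ((avg t f + avg t g) ^+ 2 - (avg t f + avg t g)) <= avg t (fun n => f n * g n).
Proof.
move=> t0 f01 g01.
have fg0 : 0 <= avg t (fun n => f n * g n).
  by apply: avg_ge0 => n; have [/andP[f0 _] /andP[g0 _]] := (f01 n, g01 n); rewrite mulr_ge0.
have fg1 : avg t f + avg t g - 1 <= avg t (fun n => f n * g n).
  rewrite -[1](avg_const _ t0) -avgD -[X in _ - X]mul1r -mulNr -avgZ -avgD.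
  apply: ler_avg => n; have [/andP[f0 f1] /andP[g0 g1]] := (f01 n, g01 n); nra.
have /andP[f0 f1] := avg_itv t0 f01; have /andP[g0 g1] := avg_itv t0 g01.
move: (avg t f) (avg t g) (avg t _) fg0 fg1 f0 f1 g0 g1 => x y z z0 z1 x0 x1 y0 y1.
have [s1|s1] := leP (x + y) 1; nra.
Qed.

Lemma square_sum_ge_pow2 (R : realFieldType) N j (f g : nat -> R) :
  N = (8 * 2 ^ j)%N ->
  periodic N f ->
  (forall n, 0 <= f n <= 1) -> (forall n, 0 <= g n <= 1) ->
  3 / 4 * (avg N f * avg N g - 3 / 10 * (avg N f * (1 - avg N f))
                             - 3 / 10 * (avg N g * (1 - avg N g)))
    <= avg N (fun x => avg N (fun a => f (x ^ 2 + a)%N * g a)).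
Proof.
pose t := (2 ^ j)%N; have t0 : (0 < t)%N by rewrite expn_gt0.
move=> NE perf f01 g01; rewrite -/t in NE.
pose u i := avg t (fun h => f (i + 8 * h)%N); pose v i := avg t (fun h => g (i + 8 * h)%N).
have u8 i : u (i + 8)%N = u i.
  rewrite /u -[RHS](avg_shift 1) => [|h]; last by rewrite -[RHS]perf; congr f; rewrite NE; ring.
  by apply: eq_avg => h; congr f; ring.
have u0 i : 0 <= u i by apply: avg_ge0 => h; case/andP: (f01 (i + 8 * h)%N).
have v0 i : 0 <= v i by apply: avg_ge0 => h; case/andP: (g01 (i + 8 * h)%N).
pose e (x y : R) := 9 / 20 * ((x + y) ^+ 2 - (x + y)).
have class c : avg 8 (fun i => e (u (c + i)%N) (v i)) <= avg N (fun a => f (c + a)%N * g a).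
  rewrite NE avg_split; apply: ler_avg => i.
  rewrite /u (_ : avg t _ = avg t (fun h => f (c + (i + 8 * h))%N)).
    exact: avg_conv_ge.
  by apply: eq_avg => h; rewrite addnA.
pose Phi x := avg N (fun a => f (x ^ 2 + a)%N * g a).
have perPhi : periodic N Phi.
  move=> x; apply: eq_avg => a; congr (_ * _).
  by rewrite -[RHS](periodicM (2 * x + N) _ perf); congr f; ring.
have Nsplit : N = (2 * (2 * (2 * t)))%N by rewrite NE; ring.
have uM k i : u (i + k * 8)%N = u i by rewrite periodicM.
have avg2 (F : nat -> R) : avg 2 F = 1 / 2 * (F 0%N + F 1%N).
  by rewrite /avg !big_ord_recl big_ord0 addr0 /= div1r.
have QE : avg N Phi = 1 / 2 * (avg (2 * (2 * t)) (fun z => Phi (2 * z)%N)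
                              + avg N (fun z => Phi (2 * z + 1)%N)).
  rewrite [in LHS]Nsplit avg_split avg2; congr (_ * (_ + _)).
  (* Odd x = 2 z + 1 already repeat after N / 2 values of z; averaging over all N values matches
     [avg_odd_square]. *)
  have per : periodic (2 * (2 * t)) (fun z => Phi (2 * z + 1)%N).
    by move=> z; rewrite -[RHS]perPhi; congr Phi; rewrite NE; ring.
  rewrite (_ : avg N (fun z => Phi (2 * z + 1)%N) = avg (2 * (2 * t)) (fun z => Phi (2 * z + 1)%N)).
    by apply: eq_avg => z; rewrite addnC.
  by rewrite -(@avg_periods _ 2 _ _ _ per) //; congr avg; rewrite NE; ring.
have odd_part : avg N (fun z => Phi (2 * z + 1)%N) = avg 8 (fun i => u (1 + i)%N * v i).
  rewrite /Phi exchange_avg.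
  transitivity (avg N (fun a => u (1 + a)%N * g a)).
    apply: eq_avg => a; have -> : u (1 + a)%N = avg N (fun z => f ((2 * z + 1) ^ 2 + a)%N).
      by rewrite NE avg_odd_square // -/t -NE.
    by rewrite mulrC -avgZ; apply: eq_avg => z; rewrite mulrC.
  rewrite NE avg_split; apply: eq_avg => i; rewrite -avgZ.
  by apply: eq_avg => h; rewrite addnA [(8 * h)%N]mulnC uM.
have even_part : avg 8 (fun i => 1 / 2 * (e (u i) (v i) + e (u (4 + i)%N) (v i)))
    <= avg (2 * (2 * t)) (fun z => Phi (2 * z)%N).
  rewrite avgZ avgD avg_split avg2; have t20 : (0 < 2 * t)%N by rewrite muln_gt0.
  apply: ler_wpM2l; first lra.
  (* (2 z)^2 is 0 mod 8 for even z and 4 mod 8 for odd z *)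
  apply: lerD; rewrite -[leLHS](avg_const _ t20); apply: ler_avg => h.
    apply: le_trans (class _); rewrite le_eqVlt; apply/orP; left.
    apply/eqP/eq_avg => i; congr (e _ _).
    by rewrite -[LHS](uM (2 * h ^ 2)%N); congr u; ring.
  apply: le_trans (class _); rewrite le_eqVlt; apply/orP; left.
  apply/eqP/eq_avg => i; congr (e _ _).
  by rewrite -[LHS](uM (2 * h ^ 2 + 2 * h)%N); congr u; ring.
have fE : avg N f = avg 8 u by rewrite NE avg_split.
have gE : avg N g = avg 8 v by rewrite NE avg_split.
have avg8 (F : nat -> R) : avg 8 F
    = 1 / 8 * (F 0%N + F 1%N + F 2%N + F 3%N + F 4%N + F 5%N + F 6%N + F 7%N).
  by rewrite /avg !big_ord_recl big_ord0 addr0 /= div1r !addrA.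
change (avg N (fun x => _)) with (avg N Phi).
rewrite QE odd_part fE gE.
move: (avg (2 * _) _) even_part => E; rewrite !avg8 /e.
have u8' i : u i.+4.+4 = u i by rewrite -[RHS]u8; congr u; lia.
(* With U, V the sums of the u_i, v_i, both sides have linear part -(9/320)(U + V); the remaining
   gap is 9/320 times the octagon form. *)
have := octagon_form_ge0 u0 v0.
clearbody u v; rewrite /= ![(1 + _)%N]add1n !add4n !u8'.
move: (u 0) (u 1) (u 2) (u 3) (u 4) (u 5) (u 6) (u 7) => w0 w1 w2 w3 w4 w5 w6 w7.
move: (v 0) (v 1) (v 2) (v 3) (v 4) (v 5) (v 6) (v 7) => z0 z1 z2 z3 z4 z5 z6 z7.
lra.
Qed.

(** * Odd moduli *)

(** 2 is a unit modulo m. Concretely, 1 + 2 (h + (m - 1) / 2) = 2 h + m, so even and odd arguments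
    have equal averages, and together they fill two periods. *)
Lemma avg_double (R : realFieldType) m (f : nat -> R) c : odd m -> periodic m f ->
  avg m (fun h => f (2 * h + c)%N) = avg m f.
Proof.
move=> m_odd per; pose F n := f (n + c)%N.
have perF : periodic m F by move=> n; rewrite -[RHS]per; congr f; ring.
have -> : avg m f = avg m F by rewrite -(avg_shift c per).
have E1 : avg m (fun h => F (1 + 2 * h)%N) = avg m (fun h => F (0 + 2 * h)%N).
  have per2 : periodic m (fun h => F (1 + 2 * h)%N).
    by move=> h; rewrite -[RHS](periodicM 2 _ perF); congr F; ring.
  rewrite -(avg_shift m./2 per2); apply: eq_avg => h.
  rewrite -[RHS]perF; have := odd_double_half m; rewrite m_odd -muln2 => hm; congr F; lia.
transitivity (1 / 2 * (avg m (fun h => F (0 + 2 * h)%N) + avg m (fun h => F (1 + 2 * h)%N))).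
  rewrite E1 (_ : avg m (fun h => F (0 + _)%N) = avg m (fun h => f (2 * h + c)%N)); first lra.
  by apply: eq_avg.
rewrite -[RHS](@avg_periods _ 2) // mulnC avg_split.
by rewrite [RHS]/avg !big_ord_recl big_ord0 addr0 div1r.
Qed.

Lemma avg_scale (R : realFieldType) m (f : nat -> R) e c : odd m -> periodic m f ->
  avg m (fun h => f (c + 2 ^ e * h)%N) = avg m f.
Proof.
move=> m_odd per; elim: e c => [|e IH] c.
  by rewrite -[RHS](avg_shift c per); apply: eq_avg => h; congr f; rewrite expn0; ring.
rewrite -(IH c) -[RHS](avg_double 0 m_odd).
  by apply: eq_avg => h; congr f; rewrite expnS; ring.
by move=> h; rewrite -[RHS](periodicM (2 ^ e) _ per); congr f; ring.
Qed.

(** The projection P_u: for m-periodic [f], u x + c meets each element of the coset of c modulo the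
    subgroup generated by u equally often. *)
Definition coset_avg (R : realFieldType) m u (f : nat -> R) (c : nat) : R :=
  avg m (fun x => f (u * x + c)%N).

Lemma coset_avg_periodic (R : realFieldType) m u (f : nat -> R) :
  periodic m f -> periodic m (coset_avg m u f).
Proof. by move=> per c; apply: eq_avg => x; rewrite -[RHS]per; congr f; ring. Qed.

Lemma coset_avg_invariant (R : realFieldType) m u (f : nat -> R) k c :
  periodic m f -> coset_avg m u f (u * k + c) = coset_avg m u f c.
Proof.
move=> per; rewrite /coset_avg.
have per' : periodic m (fun x => f (u * x + c)%N).
  by move=> x; rewrite -[RHS](periodicM u _ per); congr f; ring.
by rewrite -[RHS](avg_shift k per'); apply: eq_avg => x; congr f; ring.
Qed.

(** Self-adjointness of the projection: translating j by u x fixes [h], and averaging over x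
    projects [f]. *)
Lemma avg_mul_coset (R : realFieldType) m u (f h : nat -> R) : (0 < m)%N ->
  periodic m f -> periodic m h -> (forall x j, h (u * x + j)%N = h j) ->
  avg m (fun j => f j * h j) = avg m (fun j => coset_avg m u f j * h j).
Proof.
move=> m0 perf perh inv.
transitivity (avg m (fun x => avg m (fun j => f (u * x + j)%N * h j))).
  rewrite -[LHS](avg_const _ m0); apply: eq_avg => x.
  have per : periodic m (fun j => f j * h j) by move=> j; rewrite perf perh.
  by rewrite -[LHS](avg_shift (u * x) per); apply: eq_avg => j; rewrite addnC inv.
rewrite exchange_avg; apply: eq_avg => j; rewrite mulrC -avgZ.
by apply: eq_avg => x; rewrite mulrC.
Qed.

(** Bessel's inequality, from expanding the mean square of f - h1 - h2 - h3. *)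
Lemma avg_sqr_sub (R : realFieldType) m (f h1 h2 h3 : nat -> R) :
  avg m (fun j => f j * h1 j) = avg m (fun j => h1 j * h1 j) ->
  avg m (fun j => f j * h2 j) = avg m (fun j => h2 j * h2 j) ->
  avg m (fun j => f j * h3 j) = avg m (fun j => h3 j * h3 j) ->
  avg m (fun j => h1 j * h2 j) = 0 -> avg m (fun j => h1 j * h3 j) = 0 ->
  avg m (fun j => h2 j * h3 j) = 0 ->
  avg m (fun j => h1 j * h1 j) + avg m (fun j => h2 j * h2 j)
    + avg m (fun j => h3 j * h3 j) <= avg m (fun j => f j * f j).
Proof.
move=> f1 f2 f3 h12 h13 h23.
have : 0 <= avg m (fun j => (f j - h1 j - h2 j - h3 j) ^+ 2).
  by apply: avg_ge0 => j; apply: sqr_ge0.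
rewrite (@eq_avg R m _ (fun j => f j * f j + (h1 j * h1 j + (h2 j * h2 j + (h3 j * h3 j
  + (- 2 * (f j * h1 j) + (- 2 * (f j * h2 j) + (- 2 * (f j * h3 j)
  + (2 * (h1 j * h2 j) + (2 * (h1 j * h3 j) + 2 * (h2 j * h3 j))))))))))); last first.
  by move=> j /=; ring.
rewrite !avgD !avgZ f1 f2 f3 h12 h13 h23; lra.
Qed.

Lemma coset_avg_sum (R : realFieldType) m (f : nat -> R) u : odd m -> periodic m f ->
  avg m f = 0 ->
  avg m (fun j => coset_avg m u f j * coset_avg m u f j)
  + avg m (fun j => coset_avg m u.+1 f j * coset_avg m u.+1 f j)
  + avg m (fun j => coset_avg m u.+2 f j * coset_avg m u.+2 f j)
  <= avg m (fun j => f j * f j).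
Proof.
move=> m_odd per f0; have m0 : (0 < m)%N by case: m m_odd {per f0}.
have self v : avg m (fun j => f j * coset_avg m v f j)
    = avg m (fun j => coset_avg m v f j * coset_avg m v f j).
  apply: avg_mul_coset => //; first exact: coset_avg_periodic.
  by move=> x j; rewrite coset_avg_invariant.
(* P_{v+d} P_v f = P_d P_v f = P_v P_d f, and P_d f = 0 because d is 1 or 2, a unit modulo m. *)
have two v d : (forall c, avg m (fun y => f (d * y + c)%N) = 0) ->
    avg m (fun j => coset_avg m v f j * coset_avg m (v + d) f j) = 0.
  move=> dz; rewrite (@avg_mul_coset _ m (v + d)) //.
  - rewrite -[RHS](avg_const _ m0); apply: eq_avg => j.
    rewrite (_ : coset_avg _ _ _ _ = 0) ?mul0r //.
    transitivity (avg m (fun y => coset_avg m v f (d * y + j))).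
      apply: eq_avg => y.
      by rewrite -[RHS](coset_avg_invariant _ y) //; congr coset_avg; ring.
    rewrite /coset_avg exchange_avg -[RHS](avg_const _ m0); apply: eq_avg => x.
    by rewrite -[RHS](dz (v * x + j)%N); apply: eq_avg => y; congr f; ring.
  - exact: coset_avg_periodic.
  - exact: coset_avg_periodic.
  - by move=> x j; rewrite coset_avg_invariant.
have one c : avg m (fun y => f (1 * y + c)%N) = 0.
  by rewrite -f0 -(avg_shift c per); apply: eq_avg => y; rewrite mul1n.
have dbl c : avg m (fun y => f (2 * y + c)%N) = 0 by rewrite avg_double.
have := (two u 1%N one, two u.+1 1%N one, two u 2%N dbl).
rewrite !addn1 addn2 => -[[h12 h23] h13].
exact: avg_sqr_sub.
Qed.

(** Expand the square into variables x, y and put y = x + u. After shifting j by x^2 the factors are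
    f(j) and f(2 u x + u^2 + j), and since 2 is a unit the average over x of the latter is P_u f(u^2
    + j). *)
Lemma avg_square_shift_sqr (R : realFieldType) m (f : nat -> R) : odd m -> periodic m f ->
  avg m f = 0 ->
  avg m (fun j => avg m (fun x => f (x ^ 2 + j)%N) * avg m (fun x => f (x ^ 2 + j)%N))
  <= 1 / 3 * avg m (fun j => f j * f j).
Proof.
move=> m_odd per f0; have m0 : (0 < m)%N by case: m m_odd {per f0}.
pose P := coset_avg m ^~ f; pose nu u := avg m (fun j => P u j * P u j).
have perP u : periodic m (P u) by exact: coset_avg_periodic.
(* [P u] may replace [f] because the other factor is invariant under u; then 2 x y <= x^2 + y^2,
   where both squares average to [nu u]. *)
have step u : avg m (fun j => f j * P u (u ^ 2 + j)%N) <= nu u.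
  rewrite (@avg_mul_coset _ m u f (fun j => P u (u ^ 2 + j)%N)) //; last 2 first.
  - by move=> j; rewrite addnA perP.
  - by move=> x j; rewrite addnCA /P coset_avg_invariant.
  have -> : nu u = 1 / 2 * (nu u + avg m (fun j => P u (u ^ 2 + j)%N * P u (u ^ 2 + j)%N)).
    have perPP : periodic m (fun j => P u j * P u j) by move=> j; rewrite perP.
    have <- : nu u = avg m (fun j => P u (u ^ 2 + j)%N * P u (u ^ 2 + j)%N).
      by rewrite /nu -(avg_shift (u ^ 2) perPP); apply: eq_avg => j; rewrite addnC.
    lra.
  rewrite -avgD -avgZ; apply: ler_avg => j; rewrite -/(P u j).
  have := sqr_ge0 (P u j - P u (u ^ 2 + j)%N); lra.
have nuS u : nu (u + m)%N = nu u.
  apply: eq_avg => j; rewrite /P /coset_avg; congr (_ * _); apply: eq_avg => x.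
    by rewrite -[RHS](periodicM x _ per); congr f; ring.
  by rewrite -[RHS](periodicM x _ per); congr f; ring.
have avg_nu : avg m nu <= 1 / 3 * avg m (fun j => f j * f j).
  have -> : avg m nu = 1 / 3 * avg m (fun u => nu u + nu (u + 1)%N + nu (u + 2)%N).
    by rewrite !avgD !avg_shift //; lra.
  apply: ler_wpM2l; first lra.
  rewrite -[leRHS](avg_const _ m0); apply: ler_avg => u.
  by rewrite addn1 addn2; exact: coset_avg_sum.
apply: le_trans avg_nu.
rewrite (_ : avg m _ = avg m (fun u => avg m (fun j => f j * P u (u ^ 2 + j)%N))).
  exact: ler_avg.
transitivity (avg m (fun x => avg m (fun u => avg m (fun j =>
    f j * f (u * (2 * x) + (u ^ 2 + j))%N)))).
  transitivity (avg m (fun x => avg m (fun y => avg m (fun j =>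
      f (x ^ 2 + j)%N * f (y ^ 2 + j)%N)))).
    under [RHS]eq_avg => x do rewrite exchange_avg.
    rewrite exchange_avg; apply: eq_avg => j.
    rewrite -[LHS]avgZ; apply: eq_avg => x /=.
    by rewrite [LHS]mulrC -avgZ.
  apply: eq_avg => x.
  have per1 : periodic m (fun y => avg m (fun j => f (x ^ 2 + j)%N * f (y ^ 2 + j)%N)).
    move=> y; apply: eq_avg => j; congr (_ * _).
    by rewrite -[RHS](periodicM (2 * y + m) _ per); congr f; ring.
  rewrite -(avg_shift x per1); apply: eq_avg => u.
  have per2 : periodic m (fun j => f j * f (u * (2 * x) + (u ^ 2 + j))%N).
    by move=> j; rewrite per; congr (_ * _); rewrite -[RHS]per; congr f; ring.
  rewrite -(avg_shift (x ^ 2) per2); apply: eq_avg => j.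
  by congr (f _ * f _); ring.
rewrite exchange_avg; apply: eq_avg => u; rewrite exchange_avg; apply: eq_avg => j.
rewrite avgZ; congr (_ * _); rewrite /P /coset_avg.
have per1 : periodic m (fun x => f (u * x + (u ^ 2 + j))%N).
  by move=> x; rewrite -[RHS](periodicM u _ per); congr f; ring.
by rewrite -(avg_double 0 m_odd per1); apply: eq_avg => x; rewrite addn0.
Qed.

Lemma square_sum_ge_odd (R : realFieldType) m (X Y : nat -> R) : odd m -> periodic m X ->
  avg m X * avg m Y - 3 / 10 * (avg m (fun j => X j ^+ 2) - avg m X ^+ 2)
                    - 3 / 10 * (avg m (fun j => Y j ^+ 2) - avg m Y ^+ 2)
  <= avg m (fun x => avg m (fun j => X (x ^ 2 + j)%N * Y j)).
Proof.
move=> m_odd perX; have m0 : (0 < m)%N by case: m m_odd {perX}.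
pose f j := X j + - avg m X; pose g j := Y j + - avg m Y.
have perf : periodic m f by move=> j; rewrite /f perX.
have f0 : avg m f = 0 by rewrite avgD avg_const // subrr.
have g0 : avg m g = 0 by rewrite avgD avg_const // subrr.
have var (Z : nat -> R) : avg m (fun j => (Z j + - avg m Z) * (Z j + - avg m Z))
    = avg m (fun j => Z j ^+ 2) - avg m Z ^+ 2.
  transitivity (avg m (fun j => Z j ^+ 2 + ((- 2 * avg m Z) * Z j + avg m Z ^+ 2))).
    by apply: eq_avg => j; ring.
  by rewrite !avgD avgZ avg_const //; ring.
have QE : avg m (fun x => avg m (fun j => X (x ^ 2 + j)%N * Y j))
    = avg m X * avg m Y + avg m (fun x => avg m (fun j => f (x ^ 2 + j)%N * g j)).
  rewrite -[X in X + _](avg_const _ m0) -avgD; apply: eq_avg => x.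
  transitivity (avg m (fun j => f (x ^ 2 + j)%N * g j
      + (avg m X * g j + (avg m Y * f (x ^ 2 + j)%N + avg m X * avg m Y)))).
    by apply: eq_avg => j; rewrite /f /g; ring.
  rewrite !avgD !avgZ avg_const // g0 (_ : avg m (fun j => f (_ + j)%N) = 0).
    by rewrite -[_ * \sum_(i < m) Y i]/(avg m Y); ring.
  by rewrite -[RHS]f0 -(avg_shift (x ^ 2) perf); apply: eq_avg => j; rewrite addnC.
have := avg_square_shift_sqr m_odd perf f0; rewrite (var X) => T3.
rewrite QE exchange_avg.
(* T G >= -(5/6) T^2 - (3/10) G^2 is sharp, as 4 (5/6)(3/10) = 1. The factor 1/3 bounding the mean
   of T^2 turns 5/6 into 5/18 <= 3/10. *)
have : - (5 / 6) * avg m (fun j =>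
        avg m (fun x => f (x ^ 2 + j)%N) * avg m (fun x => f (x ^ 2 + j)%N))
    + - (3 / 10) * avg m (fun j => g j * g j)
    <= avg m (fun j => avg m (fun x => f (x ^ 2 + j)%N * g j)).
  rewrite -!avgZ -avgD; apply: ler_avg => j.
  rewrite (_ : avg m (fun x => f (_ + j)%N * _) = g j * avg m (fun x => f (x ^ 2 + j)%N)).
    move: (avg m (fun x => f _)) (g j) => T G.
    have := sqr_ge0 (5 / 3 * T + G); lra.
  by rewrite -avgZ; apply: eq_avg => x; rewrite mulrC.
rewrite (var Y); have : 0 <= avg m (fun j => f j * f j).
  by apply: avg_ge0 => j; rewrite -expr2 sqr_ge0.
rewrite (var X); lra.
Qed.

(** * The general modulus *)

Definition crt_fun (R : realFieldType) M m (f : nat -> R) (i j : nat) := f (chinese M m i j).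

Lemma crt_fun_periodicl (R : realFieldType) M m (f : nat -> R) j :
  periodic (M * m) f -> periodic M (fun i => crt_fun M m f i j).
Proof.
move=> per i; rewrite /crt_fun /chinese.
by rewrite -[RHS](periodicM (egcdn m M).1 _ per); congr f; ring.
Qed.

Lemma crt_fun_periodicr (R : realFieldType) M m (f : nat -> R) i :
  periodic (M * m) f -> periodic m (crt_fun M m f i).
Proof.
move=> per j; rewrite /crt_fun /chinese.
by rewrite -[RHS](periodicM (egcdn M m).1 _ per); congr f; ring.
Qed.

Lemma crt_funE (R : realFieldType) M m (f : nat -> R) n :
  coprime M m -> periodic (M * m) f -> crt_fun M m f n n = f n.
Proof.
move=> cop per.
have perl := crt_fun_periodicl n per; have perr := crt_fun_periodicr (n %% M) per.
rewrite (periodic_congr perl (esym (modn_mod n M))) (periodic_congr perr (esym (modn_mod n m))).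
by apply: periodic_congr per _; rewrite -chinese_mod.
Qed.

(** Write n = i + 2^e h: the first argument depends only on i, while for fixed i the second runs
    over all residues mod m, since 2^e is a unit there. *)
Lemma avg_crt (R : realFieldType) e m (F : nat -> nat -> R) : odd m ->
  (forall j, periodic (2 ^ e) (F^~ j)) -> (forall i, periodic m (F i)) ->
  avg (2 ^ e * m) (fun n => F n n) = avg (2 ^ e) (fun i => avg m (F i)).
Proof.
move=> m_odd perl perr; rewrite avg_split; apply: eq_avg => i.
rewrite -(avg_scale e i m_odd (perr i)); apply: eq_avg => h.
by rewrite [(_ * h)%N]mulnC (periodicM h i (perl _)) mulnC.
Qed.

Lemma square_sum_ge (R : realFieldType) j m (A C : nat -> R) (N := (8 * 2 ^ j * m)%N) :
  odd m -> periodic N A -> periodic N C ->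
  (forall n, 0 <= A n <= 1) -> (forall n, 0 <= C n <= 1) ->
  3 / 4 * (avg N A * avg N C - 3 / 10 * (avg N A * (1 - avg N A))
                             - 3 / 10 * (avg N C * (1 - avg N C)))
    <= avg N (fun x => avg N (fun a => A (x ^ 2 + a)%N * C a)).
Proof.
move=> m_odd; rewrite /N {N} (_ : 8 * 2 ^ j = 2 ^ (j + 3))%N; last by rewrite expnD mulnC.
set M := (2 ^ (j + 3))%N; have m0 : (0 < m)%N by case: m m_odd.
have ME : M = (8 * 2 ^ j)%N by rewrite /M expnD mulnC.
have cop : coprime M m by rewrite coprimeXl // coprime2n.
move=> perA perC A01 C01.
pose FA := crt_fun M m A; pose FC := crt_fun M m C.
have FAl k : periodic M (FA^~ k) := crt_fun_periodicl k perA.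
have FAr i : periodic m (FA i) := crt_fun_periodicr i perA.
have FCl k : periodic M (FC^~ k) := crt_fun_periodicl k perC.
have FCr i : periodic m (FC i) := crt_fun_periodicr i perC.
pose X k := avg M (FA^~ k); pose Y k := avg M (FC^~ k).
have avgA : avg (M * m) A = avg m X.
  rewrite -exchange_avg -avg_crt //; apply: eq_avg => n; exact/esym/crt_funE.
have avgC : avg (M * m) C = avg m Y.
  rewrite -exchange_avg -avg_crt //; apply: eq_avg => n; exact/esym/crt_funE.
have perX : periodic m X by move=> k; apply: eq_avg => i; exact: FAr.
(* The inner average with the residues of x modulo M and modulo m treated as independent
   variables. *)
pose K x y := avg M (fun i => avg m (fun k => FA (x ^ 2 + i)%N (y ^ 2 + k)%N * FC i k)).
have QE : avg (M * m) (fun x => avg (M * m) (fun a => A (x ^ 2 + a)%N * C a))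
    = avg m (fun y => avg m (fun k => avg M (fun x => avg M (fun i =>
        FA (x ^ 2 + i)%N (y ^ 2 + k)%N * FC i k)))).
  transitivity (avg (M * m) (fun x => K x x)).
    apply: eq_avg => x.
    rewrite /K -avg_crt; first by apply: eq_avg => a; rewrite /FA /FC !crt_funE.
    - by [].
    - by move=> k i; rewrite addnA FAl FCl.
    - by move=> i k; rewrite addnA FAr FCr.
  rewrite avg_crt //; last 2 first.
  - move=> y x; apply: eq_avg => i; apply: eq_avg => k; congr (_ * _).
    by rewrite -[RHS](periodicM (2 * x + M) _ (FAl _)); congr FA; ring.
  - move=> x y; apply: eq_avg => i; apply: eq_avg => k; congr (_ * _).
    by rewrite -[RHS](periodicM (2 * y + m) _ (FAr _)); congr FA; ring.
  rewrite exchange_avg; apply: eq_avg => y.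
  under eq_avg => x do rewrite /K exchange_avg.
  exact: exchange_avg.
have sqrX : avg m (fun y => avg m (fun k => X (y ^ 2 + k)%N ^+ 2)) = avg m (fun k => X k ^+ 2).
  rewrite -[RHS](avg_const _ m0); apply: eq_avg => y.
  have per : periodic m (fun k => X k ^+ 2) by move=> k; rewrite perX.
  by rewrite -(avg_shift (y ^ 2) per); apply: eq_avg => k; rewrite addnC.
have meanX : avg m (fun y => avg m (fun k => X (y ^ 2 + k)%N)) = avg m X.
  rewrite -[RHS](avg_const _ m0); apply: eq_avg => y.
  by rewrite -(avg_shift (y ^ 2) perX); apply: eq_avg => k; rewrite addnC.
(* The bound for powers of 2 on the fibres over y^2 + k and k, expanded. Its terms 9/40 X^2 and 9/40
   Y^2 cancel the loss (3/4)(3/10) from [square_sum_ge_odd]. *)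
have fibre : avg m (fun y => avg m (fun k => 3 / 4 * (X (y ^ 2 + k)%N * Y k)
      + (9 / 40 * X (y ^ 2 + k)%N ^+ 2 + (- (9 / 40) * X (y ^ 2 + k)%N
      + (9 / 40 * Y k ^+ 2 + - (9 / 40) * Y k)))))
    <= avg (M * m) (fun x => avg (M * m) (fun a => A (x ^ 2 + a)%N * C a)).
  rewrite QE; apply: ler_avg => y; apply: ler_avg => k.
  apply: le_trans (square_sum_ge_pow2 ME (FAl (y ^ 2 + k)%N) _ _).
  - by rewrite -/(X _) -/(Y _); lra.
  - by move=> n; apply: A01.
  - by move=> n; apply: C01.
apply: le_trans fibre; rewrite avgA avgC.
have := square_sum_ge_odd Y m_odd perX.
have lin N := (@avgD R N, @avgZ R N (3 / 4), @avgZ R N (9 / 40), @avgZ R N (- (9 / 40))).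
under [in X in _ -> _ <= X]eq_avg => y do rewrite !lin.
rewrite !lin sqrX meanX !avg_const //; lra.
Qed.

(** * From sums over Z/q to averages, and the theorem *)

Lemma zq_sum_avg (R : realType) (q : nat) (wA wB : 'I_q -> R) : (0 < q)%N ->
  exists A C : nat -> R,
    [/\ periodic q A /\ periodic q C,
        (forall n, exists t, A n = wA t) /\ (forall n, exists t, C n = wB t),
        \sum_t wA t = q%:R * avg q A, \sum_t wB t = q%:R * avg q C &
        \sum_t zq_conv wA wB t * fq R t
          = q%:R * avg q (fun x => avg q (fun a => A (x ^ 2 + a)%N * C a))].
Proof.
move=> q0; have qn0 : q%:R != 0 :> R by rewrite pnatr_eq0 -lt0n.
pose res n : 'I_q := Ordinal (ltn_pmod n q0).
have resE (a : 'I_q) : res a = a by apply: val_inj; rewrite /= modn_small.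
have res_mod m n : m = n %[mod q] -> res m = res n by move=> mn; apply: val_inj.
(* [C] is wB(-n): when q divides n the subtraction gives q, which [res] sends to 0. *)
pose A n := wA (res n); pose B n := wB (res n); pose C n := B (q - n %% q)%N.
have perA : periodic q A by move=> n; rewrite /A (res_mod _ n) // modnDr.
have perC : periodic q C by move=> n; rewrite /C modnDr.
have sumE (w : 'I_q -> R) : \sum_t w t = q%:R * avg q (fun n => w (res n)).
  by rewrite /avg mulrA divff // mul1r; apply: eq_bigr => t _; rewrite resE.
(* Negation permutes residues; [rev_ord] sends i to q - 1 - i, hence the shift by 1. *)
have avgB : avg q B = avg q C.
  rewrite -[RHS](avg_shift 1 perC); congr (_ * _).
  rewrite (reindex_inj rev_ord_inj) /=; apply: eq_bigr => i _.
  rewrite /C /B; congr wB; apply: res_mod; rewrite addn1.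
  have [iq|qi] := ltnP i.+1 q; first by rewrite (modn_small iq).
  have -> : i.+1 = q by apply/eqP; rewrite eqn_leq qi ltn_ord.
  by rewrite subnn modnn subn0 modnn mod0n.
exists A, C; split; [by []| |exact: sumE|by rewrite sumE avgB|].
  by split=> n; [exists (res n)|exists (res (q - n %% q)%N)].
have fqE t : fq R t = \sum_(x : 'I_q) (zq_mul x x == t)%:R.
  rewrite /fq -sum1_card natr_sum big_mkcond /=; apply: eq_bigr => x _.
  by rewrite inE; case: eqP.
(* Weighting by [fq] turns the sum over t into a sum over x of the convolution at x^2. *)
under eq_bigr => t _ do rewrite fqE mulr_sumr.
rewrite exchange_big /= {2}/avg mulrA divff // mul1r; apply: eq_bigr => x _.
rewrite (bigD1 (zq_mul x x)) //= eqxx mulr1 big1 ?addr0; last first.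
  by move=> t; rewrite eq_sym => /negbTE->; rewrite mulr0.
pose G a := A a * B (x * x + (q - a %% q))%N.
have perG : periodic q G by move=> a; rewrite /G perA modnDr.
transitivity (avg q G).
  rewrite /zq_conv /avg; congr (_ * _); apply: eq_bigr => a _.
  rewrite /G /A resE /B modn_small //; congr (_ * wB _); apply: val_inj => /=.
  by rewrite modnDml.
(* Substituting x^2 + a for a turns the argument x^2 - a of wB into -a. *)
rewrite -(avg_shift (x ^ 2) perG).
rewrite -[RHS]/(avg q (fun a => A (x ^ 2 + a)%N * C a)); apply: eq_avg => a.
rewrite /G addnC; congr (_ * wB _); apply: res_mod.
have neg n : (q - n %% q + n = 0 %[mod q])%N.
  by rewrite -modnDmr subnK ?modnn ?mod0n // ltnW // ltn_pmod.
set n := (x ^ 2 + a)%N; apply/eqP; rewrite -(eqn_modDr n).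
have -> : (x * x + (q - n %% q) + n = x * x + (q - n %% q + n))%N by rewrite addnA.
have -> : (q - a %% q + n = x * x + (q - a %% q + a))%N by rewrite /n -mulnn; ring.
by rewrite -modnDmr neg -[eqbRHS]modnDmr neg.
Qed.

Theorem theorem3p1 (R : realType) (eps : R) (q : nat)
  (wA wB : 'I_q -> R) :
  0 < eps -> (1 <= q)%N ->
  (forall t, 0 <= wA t <= 1) -> (forall t, 0 <= wB t <= 1) ->
  (3 / 8 + eps) * q%:R <= \sum_(t : 'I_q) wA t ->
  (3 / 8 + eps) * q%:R <= \sum_(t : 'I_q) wB t ->
  \sum_(t : 'I_q) zq_conv wA wB t * fq R t >= eps / Num.sqrt 5 * q%:R.
Proof.
move=> eps0 q0 A01 B01.
have [A [C [[perA perC] [Aw Cw] -> -> ->]]] := zq_sum_avg wA wB q0.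
have qpos : 0 < q%:R :> R by rewrite ltr0n.
rewrite ![_ * q%:R]mulrC !ler_pM2l // => hA hC.
(* The modulus 8q has 2-part at least 8, so the classes mod 8 make sense even for odd q. *)
have [m m_odd qE] : exists2 m, odd m & (q * 8 = 8 * 2 ^ logn 2 q * m)%N.
  have [m cop qE] := pfactor_coprime (isT : prime 2) q0.
  by exists m; [rewrite -coprime2n|rewrite {1}qE; ring].
have lift (f : nat -> R) : periodic q f -> avg q f = avg (8 * 2 ^ logn 2 q * m) f.
  by move=> per; rewrite -qE avg_periods.
have lift_per (f : nat -> R) : periodic q f -> periodic (8 * 2 ^ logn 2 q * m) f.
  by move=> per n; rewrite -qE mulnC periodicM.
have AC01 : (forall n, 0 <= A n <= 1) /\ (forall n, 0 <= C n <= 1).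
  by split=> n; [have [t ->] := Aw n|have [t ->] := Cw n].
have := square_sum_ge m_odd (lift_per A perA) (lift_per C perC) AC01.1 AC01.2.
rewrite -(lift A) // -(lift C) //.
have <- : avg q (fun x => avg q (fun a => A (x ^ 2 + a)%N * C a))
    = avg (8 * 2 ^ logn 2 q * m) (fun x =>
        avg (8 * 2 ^ logn 2 q * m) (fun a => A (x ^ 2 + a)%N * C a)).
  rewrite lift; last first.
    move=> x; apply: eq_avg => a; congr (_ * _).
    by rewrite -[RHS](periodicM (2 * x + q) _ perA); congr A; ring.
  by apply: eq_avg => x; apply: lift => a; rewrite addnA perA perC.
(* (20/9)^2 = 400/81 < 5, so the constant 9/20 suffices. *)
have sqrt5 : 20 / 9 <= Num.sqrt 5 :> R.
  rewrite -[leLHS]ger0_norm -?sqrtr_sqr; last lra.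
  by rewrite ler_wsqrtr //; lra.
have h5 : eps / Num.sqrt 5 <= 9 / 20 * eps.
  have s0 : 0 < Num.sqrt 5 :> R by lra.
  by rewrite ler_pdivrMr //; nra.
move: (avg q A) (avg q C) hA hC => x y hx hy hQ.
apply: le_trans h5 (le_trans _ hQ).
(* At x = y = s the bound is (6/5) s (s - 3/8): this is the source of the threshold 3/8 and of 9/20
   = (6/5)(3/8). The product controls the term x y off the diagonal. *)
have : 0 <= (x - (3 / 8 + eps)) * (y - (3 / 8 + eps)) by rewrite mulr_ge0 // subr_ge0.
nra.
Qed.
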